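(* Let $n\ge 2$ and let $\mathbf{A},\mathbf{B}$ be symmetric $n\times n$ real matrices. Assume that $\mathbf{B}$ is positive definite and strictly diagonally dominant, and that $\mathbf{A}$ is copositive. Let $\lambda$ be a complementarity eigenvalue of $(\mathbf{A},\mathbf{B})$. Then $$\min_{\substack{i,j\in[n]\\ i\ne j}}\frac{s_{ij}^-(\mathbf{A},\mathbf{B})-\sqrt{s_{ij}^-(\mathbf{A},\mathbf{B})^2-4\,b_{ij}^+\,a_{ij}^-}}{2\,b_{ij}^+}\ \le\ \lambda\ \le\ \max_{\substack{i,j\in[n]\\ i\ne j}}\frac{s_{ij}^+(\mathbf{A},\mathbf{B})+\sqrt{s_{ij}^+(\mathbf{A},\mathbf{B})^2-4\,b_{ij}^-\,a_{ij}^+}}{2\,b_{ij}^-}.$$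
   Context: $[n]=\{1,\dots,n\}$; vector inequalities are componentwise. A real number $\lambda$ is a complementarity eigenvalue of $(\mathbf{A},\mathbf{B})$ if there is $\mathbf{x}\in\mathbb{R}^n$ with $(\mathbf{A}-\lambda\mathbf{B})\mathbf{x}\ge\mathbf{0}$, $\mathbf{x}\ge\mathbf{0}$, $\mathbf{x}^\top(\mathbf{A}-\lambda\mathbf{B})\mathbf{x}=0$ and $\sum_{i=1}^n x_i=1$. A matrix $\mathbf{M}=(m_{ij})$ is strictly diagonally dominant if $|m_{ii}|>\sum_{j\ne i}|m_{ij}|$ for every $i\in[n]$. A symmetric matrix $\mathbf{A}$ is copositive if $\mathbf{x}^\top\mathbf{A}\mathbf{x}\ge 0$ for all $\mathbf{x}\ge\mathbf{0}$. For $\mathbf{M}\in\mathbb{R}^{n\times n}$ set $$r_i^+(\mathbf{M}):=\sum_{j\ne i}\max\{m_{ij},0\},\quad r_i^-(\mathbf{M}):=-\sum_{j\ne i}\min\{m_{ij},0\},$$ $$m_{ij}^+:=m_{ii}m_{jj}-r_i^+(\mathbf{M})r_j^+(\mathbf{M}),\quad m_{ij}^-:=m_{ii}m_{jj}-r_i^-(\mathbf{M})r_j^-(\mathbf{M}).$$ Thus $a_{ij}^\pm$, $b_{ij}^\pm$ denote these quantities for $\mathbf{A}=(a_{ij})$ and $\mathbf{B}=(b_{ij})$. Further, $$s_{ij}^+(\mathbf{A},\mathbf{B}):=a_{ii}b_{jj}+a_{jj}b_{ii}+r_i^+(\mathbf{A})r_j^-(\mathbf{B})+r_j^+(\mathbf{A})r_i^-(\mathbf{B}),$$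 $$s_{ij}^-(\mathbf{A},\mathbf{B}):=a_{ii}b_{jj}+a_{jj}b_{ii}+r_i^-(\mathbf{A})r_j^+(\mathbf{B})+r_j^-(\mathbf{A})r_i^+(\mathbf{B}).$$ *)

(* Defs.v *)
From mathcomp Require Import all_boot all_order all_algebra.
From mathcomp Require Import reals constructive_ereal.

Set Implicit Arguments.
Unset Strict Implicit.
Unset Printing Implicit Defensive.

Import Order.TTheory GRing.Theory Num.Theory.

Local Open Scope ring_scope.

Definition quad_form (R : realType) (n : nat) (M : 'M[R]_n) (x : 'cV[R]_n) : R :=
  (x^T *m M *m x) 0 0.

Definition nonneg_vec (R : realType) (n : nat) (x : 'cV[R]_n) : Prop :=
  forall i, 0 <= x i 0.

Definition complementarity_eigenvalue (R : realType) (n : nat)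
    (A B : 'M[R]_n) (lambda : R) : Prop :=
  exists x : 'cV[R]_n,
    [/\ nonneg_vec ((A - lambda *: B) *m x),
        nonneg_vec x,
        quad_form (A - lambda *: B) x = 0
      & \sum_i x i 0 = 1].

Definition strictly_diagonally_dominant (R : realType) (n : nat)
    (M : 'M[R]_n) : Prop :=
  forall i, \sum_(j | j != i) `|M i j| < `|M i i|.

(* Symmetry is not part of the next two predicates. *)
Definition positive_definite (R : realType) (n : nat) (M : 'M[R]_n) : Prop :=
  forall x : 'cV[R]_n, x != 0 -> 0 < quad_form M x.

Definition copositive (R : realType) (n : nat) (M : 'M[R]_n) : Prop :=
  forall x : 'cV[R]_n, nonneg_vec x -> 0 <= quad_form M x.

(* The suffixes p and m stand for the superscripts + and -: rowp, rowm are
   r_i^+, r_i^-; prodp, prodm are m_ij^+, m_ij^-; sp, sm are s_ij^+, s_ij^-. *)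
Definition rowp (R : realType) (n : nat) (M : 'M[R]_n) (i : 'I_n) : R :=
  \sum_(j | j != i) Num.max (M i j) 0.

Definition rowm (R : realType) (n : nat) (M : 'M[R]_n) (i : 'I_n) : R :=
  - \sum_(j | j != i) Num.min (M i j) 0.

Definition prodp (R : realType) (n : nat) (M : 'M[R]_n) (i j : 'I_n) : R :=
  M i i * M j j - rowp M i * rowp M j.

Definition prodm (R : realType) (n : nat) (M : 'M[R]_n) (i j : 'I_n) : R :=
  M i i * M j j - rowm M i * rowm M j.

Definition sp (R : realType) (n : nat) (A B : 'M[R]_n) (i j : 'I_n) : R :=
  A i i * B j j + A j j * B i i + rowp A i * rowm B j + rowp A j * rowm B i.

Definition sm (R : realType) (n : nat) (A B : 'M[R]_n) (i j : 'I_n) : R :=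
  A i i * B j j + A j j * B i i + rowm A i * rowp B j + rowm A j * rowp B i.

Definition lower_bound (R : realType) (n : nat) (A B : 'M[R]_n)
    (i j : 'I_n) : R :=
  (sm A B i j - Num.sqrt (sm A B i j ^+ 2 - 4 * prodp B i j * prodm A i j))
    / (2 * prodp B i j).

Definition upper_bound (R : realType) (n : nat) (A B : 'M[R]_n)
    (i j : 'I_n) : R :=
  (sp A B i j + Num.sqrt (sp A B i j ^+ 2 - 4 * prodm B i j * prodp A i j))
    / (2 * prodm B i j).

(* Extrema over ordered pairs of distinct indices, taken in the extended reals
   so that +oo and -oo are neutral; for 2 <= n the range is nonempty and these
   are the usual (finite) minimum and maximum. *)
Definition min_offdiag (R : realType) (n : nat) (F : 'I_n -> 'I_n -> R) : \bar R :=
  (\big[Order.min/+oo]_(p : 'I_n * 'I_n | p.1 != p.2) (F p.1 p.2)%:E)%E.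

Definition max_offdiag (R : realType) (n : nat) (F : 'I_n -> 'I_n -> R) : \bar R :=
  (\big[Order.max/-oo]_(p : 'I_n * 'I_n | p.1 != p.2) (F p.1 p.2)%:E)%E.

(* Main.v *)
Require Import Defs.
From mathcomp Require Import all_boot all_order all_algebra.
From mathcomp Require Import reals constructive_ereal.
From mathcomp Require Import ring lra.

Import Order.TTheory GRing.Theory Num.Theory.

Local Open Scope ring_scope.

(** Let [x] be an eigenvector, [x i] its largest and [x j] its second largest
    entry. Complementarity turns rows [i] and [j] (when [x j > 0]) into
    equalities, and bounding the off-diagonal part of each row by the row sums
    gives [(lambda b_ii - a_ii) x_i <= (r_i^+(A) + lambda r_i^-(B)) x_j] and the
    same with [i] and [j] exchanged; here [0 <= lambda] is used. If both left
    sides are positive, multiplying shows that the quadratic with leading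
    coefficient [b_ij^-] is nonpositive at [lambda], so [lambda] lies between
    its roots. Otherwise [lambda <= mu] for [mu = a_ii / b_ii] or
    [mu = a_jj / b_jj], where the quadratic is clearly nonpositive. The lower
    bound is dual. *)

(** * Scalar inequalities for one pair of indices *)

Lemma le_quadratic_roots (R : realType) (d s c l : R) :
  0 < d -> d * l ^+ 2 - s * l + c <= 0 ->
  (s - Num.sqrt (s ^+ 2 - 4 * d * c)) / (2 * d) <= l /\
  l <= (s + Num.sqrt (s ^+ 2 - 4 * d * c)) / (2 * d).
Proof.
move=> d_gt0 q_le0; set D := s ^+ 2 - _.
(* Completing the square: [D - (2 * d * l - s) ^+ 2] is [- 4 * d] times the quadratic, hence
   nonnegative. *)
have : `|2 * d * l - s| <= Num.sqrt D.
  rewrite -sqrtr_sqr ler_wsqrtr // /D -subr_ge0.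
  have -> : s ^+ 2 - 4 * d * c - (2 * d * l - s) ^+ 2
            = 4 * d * - (d * l ^+ 2 - s * l + c) by ring.
  by rewrite mulr_ge0 ?oppr_ge0 // mulr_ge0 // ltW.
rewrite ler_norml => /andP[lo hi].
have d2_gt0 : 0 < 2 * d by rewrite mulr_gt0.
by rewrite ler_pdivrMr // ler_pdivlMr //; split; lra.
Qed.

(** Expanding both products gives exactly this quadratic. Here [u] stands for a row sum of [A] and
    [v] for the row sum of [B] of opposite sign. *)
Lemma pair_quadratic (R : realType) (ai aj bi bj ui uj vi vj l : R) :
  (l * bi - ai) * (l * bj - aj) <= (ui + l * vi) * (uj + l * vj) ->
  (bi * bj - vi * vj) * l ^+ 2 - (ai * bj + aj * bi + ui * vj + uj * vi) * l
    + (ai * aj - ui * uj) <= 0.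
Proof. by move=> ?; lra. Qed.

(** At [l = ai / bi] the factor [l * bi - ai] vanishes, while the product of row sums stays
    nonnegative. *)
Lemma pair_quadratic_ratio (R : realType) (ai aj bi bj ui uj vi vj : R) :
  0 <= ai -> 0 < bi -> 0 <= ui -> 0 <= uj -> 0 <= vi -> 0 <= vj ->
  (bi * bj - vi * vj) * (ai / bi) ^+ 2
    - (ai * bj + aj * bi + ui * vj + uj * vi) * (ai / bi)
    + (ai * aj - ui * uj) <= 0.
Proof.
move=> ai_ge0 bi_gt0 ui_ge0 uj_ge0 vi_ge0 vj_ge0; apply: pair_quadratic.
have mu_ge0 : 0 <= ai / bi by rewrite divr_ge0 // ltW.
rewrite divfK ?gt_eqF // subrr mul0r.
by rewrite mulr_ge0 // addr_ge0 // mulr_ge0.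
Qed.

(** If [y = 0], the first inequality contradicts [0 < p * x]; otherwise multiply the two and cancel
    [x * y]. The second is guarded by [0 < y] because complementarity gives a row equation only at
    positive entries. *)
Lemma ler_pair_mul (R : realType) (p q P Q x y : R) :
  0 < p -> 0 < q -> 0 <= P -> 0 <= Q -> 0 < x -> 0 <= y ->
  p * x <= P * y -> (0 < y -> q * y <= Q * x) -> p * q <= P * Q.
Proof.
move=> p_gt0 q_gt0 P_ge0 Q_ge0 x_gt0; rewrite le_eqVlt => /orP[/eqP<-|y_gt0].
  by rewrite mulr0 leNgt mulr_gt0.
move=> pxy /(_ y_gt0) qyx.
have xy_gt0 : 0 < x * y by rewrite mulr_gt0.
rewrite -(ler_pM2r xy_gt0).
have -> : p * q * (x * y) = (p * x) * (q * y) by ring.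
have -> : P * Q * (x * y) = (P * y) * (Q * x) by ring.
by apply: ler_pM => //; rewrite mulr_ge0 // ltW.
Qed.

Lemma le_pair_root_upper (R : realType) (ai aj bi bj ui uj vi vj x y l : R) :
  0 <= ai -> 0 <= aj -> 0 < bi -> 0 < bj ->
  0 <= ui -> 0 <= uj -> 0 <= vi -> 0 <= vj -> vi * vj < bi * bj ->
  0 <= l -> 0 < x -> 0 <= y ->
  (l * bi - ai) * x <= (ui + l * vi) * y ->
  (0 < y -> (l * bj - aj) * y <= (uj + l * vj) * x) ->
  let s := ai * bj + aj * bi + ui * vj + uj * vi in
  let d := bi * bj - vi * vj in
  is_true (l <= (s + Num.sqrt (s ^+ 2 - 4 * d * (ai * aj - ui * uj))) / (2 * d)).
Proof.
move=> ai_ge0 aj_ge0 bi_gt0 bj_gt0 ui_ge0 uj_ge0 vi_ge0 vj_ge0 vb l_ge0 x_gt0.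
move=> y_ge0 row_i row_j s d; have d_gt0 : 0 < d by rewrite subr_gt0.
have [lei|lti] := leP (l * bi) ai.
  apply: (@le_trans _ _ (ai / bi)); first by rewrite ler_pdivlMr.
  by apply: (le_quadratic_roots _ _ _ _ _ d_gt0 _).2; exact: pair_quadratic_ratio.
have [lej|ltj] := leP (l * bj) aj.
  apply: (@le_trans _ _ (aj / bj)); first by rewrite ler_pdivlMr.
  apply: (le_quadratic_roots _ _ _ _ _ d_gt0 _).2.
  (* The quadratic is symmetric under exchanging [i] and [j]. *)
  have := @pair_quadratic_ratio _ aj ai bj bi uj ui vj vi aj_ge0 bj_gt0 uj_ge0 ui_ge0 vj_ge0 vi_ge0.
  by rewrite /d /s; lra.
apply: (le_quadratic_roots _ _ _ _ _ d_gt0 _).2; apply: pair_quadratic.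
apply: ler_pair_mul row_i row_j; rewrite ?subr_gt0 //.
  by rewrite addr_ge0 // mulr_ge0.
by rewrite addr_ge0 // mulr_ge0.
Qed.

Lemma le_pair_root_lower (R : realType) (ai aj bi bj ui uj vi vj x y l : R) :
  0 <= ai -> 0 <= aj -> 0 < bi -> 0 < bj ->
  0 <= ui -> 0 <= uj -> 0 <= vi -> 0 <= vj -> vi * vj < bi * bj ->
  0 <= l -> 0 < x -> 0 <= y ->
  (ai - l * bi) * x <= (ui + l * vi) * y ->
  (0 < y -> (aj - l * bj) * y <= (uj + l * vj) * x) ->
  let s := ai * bj + aj * bi + ui * vj + uj * vi in
  let d := bi * bj - vi * vj in
  is_true ((s - Num.sqrt (s ^+ 2 - 4 * d * (ai * aj - ui * uj))) / (2 * d) <= l).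
Proof.
move=> ai_ge0 aj_ge0 bi_gt0 bj_gt0 ui_ge0 uj_ge0 vi_ge0 vj_ge0 vb l_ge0 x_gt0.
move=> y_ge0 row_i row_j s d; have d_gt0 : 0 < d by rewrite subr_gt0.
have [lei|lti] := leP ai (l * bi).
  apply: (@le_trans _ _ (ai / bi)); last by rewrite ler_pdivrMr.
  by apply: (le_quadratic_roots _ _ _ _ _ d_gt0 _).1; exact: pair_quadratic_ratio.
have [lej|ltj] := leP aj (l * bj).
  apply: (@le_trans _ _ (aj / bj)); last by rewrite ler_pdivrMr.
  apply: (le_quadratic_roots _ _ _ _ _ d_gt0 _).1.
  have := @pair_quadratic_ratio _ aj ai bj bi uj ui vj vi aj_ge0 bj_gt0 uj_ge0 ui_ge0 vj_ge0 vi_ge0.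
  by rewrite /d /s; lra.
apply: (le_quadratic_roots _ _ _ _ _ d_gt0 _).1; apply: pair_quadratic.
(* Both factors [l * b - a] are negative here; flipping both signs keeps their product. *)
rewrite -mulrNN !opprB.
apply: ler_pair_mul row_i row_j; rewrite ?subr_gt0 //.
  by rewrite addr_ge0 // mulr_ge0.
by rewrite addr_ge0 // mulr_ge0.
Qed.

(** * Row sums, diagonal entries and rows of the pencil *)

Section RowSums.
Variables (R : realType) (n : nat).
Implicit Types (M A B : 'M[R]_n) (x : 'cV[R]_n) (l t : R).

Lemma rowp_ge0 M i : 0 <= rowp M i.
Proof. by apply: sumr_ge0 => j _; rewrite le_max lexx orbT. Qed.

Lemma rowmE M i : rowm M i = \sum_(j | j != i) - Num.min (M i j) 0.
Proof. by rewrite sumrN. Qed.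

Lemma rowm_ge0 M i : 0 <= rowm M i.
Proof. by rewrite rowmE; apply: sumr_ge0 => j _; rewrite oppr_ge0 ge_min lexx orbT. Qed.

Lemma rowp_le_norm M i : rowp M i <= \sum_(j | j != i) `|M i j|.
Proof. by apply: ler_sum => j _; rewrite ge_max ler_norm normr_ge0. Qed.

Lemma rowm_le_norm M i : rowm M i <= \sum_(j | j != i) `|M i j|.
Proof.
rewrite rowmE; apply: ler_sum => j _.
by rewrite lerNl le_min lerNl -normrN ler_norm oppr_le0 normr_ge0.
Qed.

Lemma quad_formE M x : quad_form M x = \sum_i x i 0 * (M *m x) i 0.
Proof. by rewrite /quad_form -mulmxA mxE; apply: eq_bigr => i _; rewrite mxE. Qed.

Lemma quad_form_delta M i : quad_form M (delta_mx i 0) = M i i.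
Proof.
by rewrite /quad_form trmx_delta -rowE -colE !mxE.
Qed.

Lemma quad_form_pencil A B l x :
  quad_form (A - l *: B) x = quad_form A x - l * quad_form B x.
Proof. by rewrite /quad_form mulmxBr mulmxBl -scalemxAr -scalemxAl !mxE. Qed.

Lemma copositive_diag_ge0 M i : copositive M -> 0 <= M i i.
Proof.
move=> M_cop; rewrite -quad_form_delta; apply: M_cop => j.
by rewrite mxE ler0n.
Qed.

Lemma positive_definite_diag_gt0 M i : positive_definite M -> 0 < M i i.
Proof.
move=> M_pd; rewrite -quad_form_delta; apply: M_pd.
by apply/eqP => /matrixP/(_ i 0)/eqP; rewrite !mxE !eqxx oner_eq0.
Qed.

Lemma mulmx_offdiag M x i :
  (M *m x) i 0 = M i i * x i 0 + \sum_(k | k != i) M i k * x k 0.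
Proof. by rewrite mxE (bigD1 i). Qed.

(** The coefficients [f k] may be negative, so they are first replaced by the nonnegative [w k];
    only then can [y k] be raised to [t]. *)
Lemma le_weighted_sum (I : finType) (P : pred I) (f w y : I -> R) (t : R) :
  (forall k, f k <= w k) -> (forall k, 0 <= w k) -> (forall k, 0 <= y k) ->
  (forall k, P k -> y k <= t) ->
  \sum_(k | P k) f k * y k <= (\sum_(k | P k) w k) * t.
Proof.
move=> fw w_ge0 y_ge0 y_le; rewrite mulr_suml; apply: ler_sum => k Pk.
by apply: (@le_trans _ _ (w k * y k)); [rewrite ler_wpM2r|rewrite ler_wpM2l ?y_le].
Qed.

(** Since [0 <= l], each coefficient [A i k - l * B i k] is at most
    [max (A i k) 0 - l * min (B i k) 0], which is nonnegative. *)
Lemma row_upper A B l x i t :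
  0 <= l -> (forall k, 0 <= x k 0) -> (forall k, k != i -> x k 0 <= t) ->
  ((A - l *: B) *m x) i 0 = 0 ->
  (l * B i i - A i i) * x i 0 <= (rowp A i + l * rowm B i) * t.
Proof.
move=> l_ge0 x_ge0 x_le; rewrite mulmx_offdiag => row0.
have -> : (l * B i i - A i i) * x i 0
          = \sum_(k | k != i) (A - l *: B) i k * x k 0.
  by move: row0; rewrite !mxE; lra.
rewrite rowmE mulr_sumr -big_split /=; apply: le_weighted_sum => // k.
  rewrite !mxE lerD ?le_max ?lexx // mulrN lerN2 ler_wpM2l //.
  by rewrite ge_min lexx.
by rewrite addr_ge0 ?le_max ?lexx ?orbT // mulr_ge0 // oppr_ge0 ge_min lexx orbT.
Qed.

Lemma row_lower A B l x i t :
  0 <= l -> (forall k, 0 <= x k 0) -> (forall k, k != i -> x k 0 <= t) ->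
  ((A - l *: B) *m x) i 0 = 0 ->
  (A i i - l * B i i) * x i 0 <= (rowm A i + l * rowp B i) * t.
Proof.
move=> l_ge0 x_ge0 x_le; rewrite mulmx_offdiag => row0.
have -> : (A i i - l * B i i) * x i 0
          = \sum_(k | k != i) (l * B i k - A i k) * x k 0.
  have -> : \sum_(k | k != i) (l * B i k - A i k) * x k 0
            = - \sum_(k | k != i) (A - l *: B) i k * x k 0.
    by rewrite -sumrN; apply: eq_bigr => k _; rewrite !mxE; ring.
  by move: row0; rewrite !mxE; lra.
rewrite rowmE mulr_sumr -big_split /=; apply: le_weighted_sum => // k.
  rewrite (addrC (l * B i k)) lerD ?lerN2 ?ge_min ?lexx //.
  by rewrite ler_wpM2l // le_max lexx.
by rewrite addr_ge0 ?oppr_ge0 ?ge_min ?lexx ?orbT // mulr_ge0 // le_max lexx orbT.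
Qed.

(** The quadratic form is a sum of nonnegative terms [x k 0 * (M *m x) k 0], so each term
    vanishes. *)
Lemma complementarity_row M x i :
  nonneg_vec (M *m x) -> nonneg_vec x -> quad_form M x = 0 ->
  0 < x i 0 -> (M *m x) i 0 = 0.
Proof.
move=> Mx_ge0 x_ge0 /eqP; rewrite quad_formE psumr_eq0; last first.
  by move=> k _; rewrite mulr_ge0.
move=> /allP/(_ i (mem_index_enum _)) /=; rewrite mulf_eq0 => /orP[/eqP->|/eqP//].
by rewrite ltxx.
Qed.

Lemma sdd_diag_gt M i (w : R) :
  strictly_diagonally_dominant M -> 0 < M i i ->
  w <= \sum_(j | j != i) `|M i j| -> w < M i i.
Proof.
by move=> M_sdd /gtr0_norm <- w_le; apply: le_lt_trans w_le (M_sdd i).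
Qed.

End RowSums.

(** * The two largest entries and the conclusion *)

Lemma two_largest (R : realType) (n : nat) (y : 'I_n -> R) :
  (2 <= n)%N ->
  exists i j, [/\ i != j, forall k, y k <= y i & forall k, k != i -> y k <= y j].
Proof.
case: n y => [//|[//|n]] y _.
pose i := [arg max_(k > ord0) y k]%O.
have max_i k : y k <= y i by rewrite /i; case: arg_maxP => // m _; apply.
(* An index other than [i], so that the second maximum ranges over a nonempty set; this uses
   [2 <= n]. *)
pose j0 := lift i (ord0 : 'I_n.+1).
have j0_neq : j0 != i by rewrite eq_sym neq_lift.
case: (@arg_maxP _ _ _ j0 (fun k => k != i) y j0_neq) => j j_neq max_j.
by exists i, j; split => //; rewrite eq_sym.
Qed.

Theorem corollary4p2 (R : realType) (n : nat) (A B : 'M[R]_n) (lambda : R)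
    (n_ge2 : (2 <= n)%N)
    (A_sym : A^T = A) (B_sym : B^T = B)
    (B_pd : positive_definite B)
    (B_sdd : strictly_diagonally_dominant B)
    (A_cop : copositive A)
    (lambda_ev : complementarity_eigenvalue A B lambda) :
  (min_offdiag (lower_bound A B) <= lambda%:E)%E /\
  (lambda%:E <= max_offdiag (upper_bound A B))%E.
Proof.
have [x [Cx_ge0 x_ge0 xCx x_sum]] := lambda_ev.
have x_neq0 : x != 0.
  apply: contra_eq_neq x_sum => ->.
  by rewrite big1 ?(eq_sym 0) ?oner_neq0 // => i _; rewrite mxE.
(* The vanishing form makes [lambda] the quotient of [quad_form A x] by the positive
   [quad_form B x]. *)
have l_ge0 : 0 <= lambda.
  have B_gt0 := B_pd _ x_neq0; have := A_cop _ x_ge0.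
  move/eqP: xCx; rewrite quad_form_pencil subr_eq0 => /eqP->.
  by rewrite pmulr_lge0.
have [i [j [ij max_i max_j]]] := @two_largest R n (fun k => x k 0) n_ge2.
have xi_gt0 : 0 < x i 0.
  rewrite lt_def x_ge0 andbT; apply: contra_neq x_neq0 => xi0.
  by apply/colP => k; rewrite mxE; apply/eqP; rewrite eq_le x_ge0 -xi0 max_i.
have row0 k := complementarity_row _ _ (A - lambda *: B) x k Cx_ge0 x_ge0 xCx.
have a_ge0 k := copositive_diag_ge0 _ _ A k A_cop.
have b_gt0 k := positive_definite_diag_gt0 _ _ B k B_pd.
(* Multiplied over [i] and [j], these strict bounds make the leading coefficients [prodp B i j] and
   [prodm B i j] positive. *)
have rowp_lt k : rowp B k < B k k.
  by apply: sdd_diag_gt => //; exact: rowp_le_norm.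
have rowm_lt k : rowm B k < B k k.
  by apply: sdd_diag_gt => //; exact: rowm_le_norm.
split.
  (* The bound at the single pair [(i, j)] suffices, as the minimum is at most its value there. *)
  have: lower_bound A B i j <= lambda.
    apply: (@le_pair_root_lower _ _ _ _ _ _ _ _ _ (x i 0) (x j 0)) => //;
      rewrite ?rowp_ge0 ?rowm_ge0 //.
    - by apply: ltr_pM; rewrite ?rowp_ge0.
    - by apply: row_lower => //; exact: row0.
    - by move=> xj_gt0; apply: row_lower => //; exact: row0.
  by rewrite -lee_fin; apply: le_trans; apply: (bigmin_le_cond _ (j := (i, j))).
have: lambda <= upper_bound A B i j.
  apply: (@le_pair_root_upper _ _ _ _ _ _ _ _ _ (x i 0) (x j 0)) => //;
    rewrite ?rowp_ge0 ?rowm_ge0 //.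
  - by apply: ltr_pM; rewrite ?rowm_ge0.
  - by apply: row_upper => //; exact: row0.
  - by move=> xj_gt0; apply: row_upper => //; exact: row0.
rewrite -lee_fin => /le_trans; apply.
exact: (le_bigmax_cond _ _ (j := (i, j))).
Qed.
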